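(* For each integer $n>0$ there are compact Haar-$1$ sets $A_0,\ldots,A_n\subseteq\mathbb{R}$ such that $A_0\cup\ldots\cup A_n$ is Haar-$(n+1)$ but not Haar-$n$. In particular, there is a closed Haar-$(n+1)$ subset of $\mathbb{R}$ which is not Haar-$n$.
   Context: A Cantor set is a homeomorphic copy of $2^\omega$. For $n\geq 1$, a set $A\subseteq\mathbb{R}$ is Haar-$n$ if there are a Borel set $B\subseteq\mathbb{R}$ with $A\subseteq B$ and a Cantor set $D\subseteq\mathbb{R}$ such that $|(D+x)\cap B|\leq n$ for all $x\in\mathbb{R}$. *)

(* Defs.v *)
From mathcomp Require Import all_boot all_order all_algebra.
From mathcomp Require Import all_classical all_reals all_analysis.
Import Order.TTheory GRing.Theory Num.Theory.
Import numFieldNormedType.Exports.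

Set Implicit Arguments.
Unset Strict Implicit.
Unset Printing Implicit Defensive.

Local Open Scope classical_set_scope.
Local Open Scope ring_scope.

(* [f] is a homeomorphism onto the subspace [D] with inverse [g]; only the
   values of [g] on [D] matter. *)
Definition is_cantor_set (R : realType) (D : set R) : Prop :=
  exists (f : cantor_space -> R) (g : R -> cantor_space),
    [/\ continuous f, f @` [set: cantor_space] = D,
        cancel f g & {within D, continuous g}].

Definition translate (R : realType) (D : set R) (x : R) : set R :=
  [set d + x | d in D].

Definition haar (R : realType) (n : nat) (A : set R) : Prop :=
  exists (B D : set R),
    [/\ <<s (@open R) >> B, A `<=` B, is_cantor_set D &
        forall x : R, (translate D x `&` B #<= `I_n)%card].

(* Main.v *)
(* Put [p = n + 1] and let [A_i] be the set of [x] in [[-5, 5]] such that, for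
   every [k] congruent to [i] mod [p], the fractional part of [10^k x] is at most
   [1/5]. The constraints on different [A_i] live at different decimal scales, so
   for any [t_0, ..., t_n] in [[-1, 1]] a single [x] with [t_i + x] in [A_i] for
   all [i] can be built digit by digit; as every Cantor set has [n + 1] points
   within distance 1 of a common centre, the union is not Haar-[n]. Conversely,
   let [D] be the set of reals whose decimal digits are 0 or 5 and constant on
   blocks of length [p]. Two distinct points of [D] have different digits
   throughout some block, so for each [i] there is [k = i] mod [p] for which
   [10^k] times their difference is close to a half-integer; this excludes the
   difference from every [A_i - A_i], so each translate of [D] meets each [A_i] at
   most once. *)
Require Import Defs.
From mathcomp Require Import all_boot all_order all_algebra.
From mathcomp Require Import all_classical all_reals all_analysis.
From mathcomp Require Import ring lra.
Import Order.TTheory GRing.Theory Num.Theory.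
Import numFieldNormedType.Exports.

Set Implicit Arguments.
Unset Strict Implicit.

Local Open Scope classical_set_scope.
Local Open Scope ring_scope.

(** * Decimal limits and the topology of Cantor space *)

Lemma nested_decimal (R : realType) (u : nat -> R) :
  (forall k, u k <= u k.+1 <= u k + (10 ^+ k)^-1) ->
  exists x, forall k, u k <= x <= u k + 2 / 10 ^+ k.
Proof.
move=> hu; pose v k := u k + 2 / 10 ^+ k.
have u_mono : {homo u : i j / (i <= j)%N >-> i <= j}.
  by apply: homo_leq => [//|? ? ?|k]; [exact: le_trans|case/andP: (hu k)].
(* The intervals [[u k, v k]] are nested since 1 + 2/10 <= 2; the supremum of the [u k] lies in all
   of them. *)
have v_mono : {homo v : i j / (i <= j)%N >-> j <= i}.
  apply: homo_leq => [//|y x z xy yz|k]; first exact: le_trans yz xy.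
  have /andP[_ h] := hu k; have p0 : 0 < (10 ^+ k)^-1 :> R.
    by rewrite invr_gt0 exprn_gt0.
  by rewrite /v exprS invfM; lra.
have uv i j : u i <= v j.
  have /le_trans : u i <= u (maxn i j) by exact/u_mono/leq_maxl.
  apply; have /(le_trans _) : v (maxn i j) <= v j by exact/v_mono/leq_maxr.
  by apply; rewrite lerDl divr_ge0// exprn_ge0.
have ub : has_ubound (range u) by exists (v 0%N) => _ [i _ <-]; exact: uv.
exists (sup (range u)) => k; apply/andP; split.
  by apply: ub_le_sup => //; exists k.
by apply: ge_sup => [|_ [i _ <-]]; [exists (u 0%N), 0%N|exact: uv].
Qed.

Lemma cvg_cantor_space (F : set_system cantor_space) (z : cantor_space) :
  Filter F -> (forall j, F [set z' | z' j = z j]) -> F --> z.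
Proof.
move=> FF h; apply/cvg_sup => j A /= [_ [[C oC <-] Cz sub]].
by apply: filterS (h j) => z' /= e; apply: sub; rewrite /= e.
Qed.

Lemma near_cylinder (z : cantor_space) (m : nat) :
  nbhs z [set z' : cantor_space | forall j, (j < m)%N -> z' j = z j].
Proof.
elim: m => [|m IH]; first by apply: filterE => z1 j; rewrite ltn0.
have hm : nbhs z [set z' : cantor_space | z' m = z m].
  exact: (@proj_continuous nat (fun=> bool) m z _ (discrete_set1 (z m))).
apply: filterS2 IH hm => z' h e j.
by rewrite ltnS leq_eqVlt => /predU1P[->|/h].
Qed.

Lemma half_dist_int (R : realType) (m : int) : 1 / 2 <= `|m%:~R + 1 / 2| :> R.
Proof.
have [m0|m0] := leP 0 m.
  have : 0 <= m%:~R :> R by rewrite ler0z.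
  by move=> ?; rewrite ger0_norm; lra.
have : m%:~R <= (-1)%:~R :> R by rewrite ler_int -ltzD1.
by move=> ?; rewrite ler0_norm; lra.
Qed.

(** * Reals with block-constant decimals 0 and 5 *)

(* Partial sums of the real number whose [k]-th decimal is 5 if [z (k %/ p)] and
   0 otherwise. *)
Definition block_sum (R : realType) (p : nat) (z : cantor_space) (m : nat) : R :=
  \sum_(k < m) (z (k %/ p)%N)%:R * (5 / 10 ^+ k.+1).

Lemma block_sumS (R : realType) p z m :
  block_sum R p z m.+1 = block_sum R p z m + (z (m %/ p)%N)%:R * (5 / 10 ^+ m.+1).
Proof. by rewrite /block_sum big_ord_recr. Qed.

Lemma block_sum_int (R : realType) p z m :
  exists i : int, 10 ^+ m * block_sum R p z m = i%:~R.
Proof.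
elim: m => [|m [i IH]]; first by exists 0; rewrite /block_sum big_ord0 mulr0.
exists (i * 10 + (z (m %/ p)%N)%:Z * 5).
rewrite block_sumS intrD !intrM -IH exprS; field.
by rewrite expf_neq0.
Qed.

Definition block_limit (R : realType) (p : nat) (f : cantor_space -> R) :=
  forall z k, block_sum R p z k <= f z <= block_sum R p z k + 2 / 10 ^+ k.

Lemma block_limit_exists (R : realType) (p : nat) :
  exists f : cantor_space -> R, block_limit p f.
Proof.
have [z|f hf] := choice (_ : forall z, exists x, forall k,
    block_sum R p z k <= x <= block_sum R p z k + 2 / 10 ^+ k); last by exists f.
apply: nested_decimal => k.
have p0 : 0 < (10 ^+ k)^-1 :> R by rewrite invr_gt0 exprn_gt0.
by rewrite block_sumS exprS invfM; case: (z _) => /=; lra.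
Qed.

(** After scaling by 10^k, the digits before position [k] contribute an integer, the differing
    digits 1/2 or -1/2, and each tail lies in [0, 1/5]. *)
Lemma block_limit_gap (R : realType) p (f : cantor_space -> R) z z' k :
  block_limit p f -> z (k %/ p)%N != z' (k %/ p)%N ->
  exists m : int, `|10 ^+ k * (f z - f z') - (m%:~R + 1 / 2)| <= 1 / 5.
Proof.
move=> hf ne; have := hf z k.+1; have := hf z' k.+1; rewrite !block_sumS.
have [i hi] := block_sum_int R p z k; have [i' hi'] := block_sum_int R p z' k.
have q0 : 0 < (10 ^+ k) :> R by rewrite exprn_gt0.
have scale (a b x : R) : a + b * (5 / 10 ^+ k.+1) <= x <=
    a + b * (5 / 10 ^+ k.+1) + 2 / 10 ^+ k.+1 ->
    10 ^+ k * a + b / 2 <= 10 ^+ k * x <= 10 ^+ k * a + b / 2 + 1 / 5.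
  rewrite -(ler_pM2l q0) -[X in _ && X](ler_pM2l q0).
  have -> : 10 ^+ k * (a + b * (5 / 10 ^+ k.+1)) = 10 ^+ k * a + b / 2.
    by rewrite exprS; field; rewrite lt0r_neq0.
  congr (_ <= _ <= _); rewrite exprS; field; rewrite lt0r_neq0//.
move=> /scale b' /scale b; move: b b'; rewrite hi hi' => b b'.
(* A contribution of -1/2 is rewritten as -1 + 1/2. *)
exists (i - i' - (~~ z (k %/ p)%N)%:Z).
rewrite mulrBr !intrB ler_norml.
by move: ne b b'; case: (z _); case: (z' _) => //= _; lra.
Qed.

(** If [z] and [z'] differ at [j], the scaled difference is within 1/5 of a half-integer, so at
    least 3/10 > 1/4 away from 0. This gives both injectivity of [f] and continuity of its
    inverse. *)
Lemma block_limit_separation (R : realType) p (f : cantor_space -> R) z z' j :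
  (0 < p)%N -> block_limit p f -> `|f z - f z'| < (4 * 10 ^+ (j * p))^-1 ->
  z j = z' j.
Proof.
move=> p0 hf lt; apply/eqP/negPn/negP; rewrite -{1 2}(mulnK j p0) => ne.
have [m hm] := block_limit_gap hf ne.
have := half_dist_int R m.
have : `|10 ^+ (j * p) * (f z - f z')| < 1 / 4.
  rewrite normrM ger0_norm ?exprn_ge0// mulrC -ltr_pdivlMr ?exprn_gt0//.
  by apply: (lt_le_trans lt); rewrite invfM mul1r.
have := ler_normB (10 ^+ (j * p) * (f z - f z'))
  (10 ^+ (j * p) * (f z - f z') - (m%:~R + 1 / 2)).
by rewrite opprB addrC subrK; lra.
Qed.

Lemma block_limit_continuous (R : realType) p (f : cantor_space -> R) :
  block_limit p f -> continuous f.
Proof.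
move=> hf z; apply/cvgrPdist_lt => e e0.
have [m hm] : exists m, 2 / 10 ^+ m < e.
  have h10 : `|10^-1 : R| < 1 by rewrite ger0_norm; lra.
  have /cvgrPdist_lt/(_ _ e0)[m _ /(_ m (leqnn m))] := cvg_geometric 2 h10.
  rewrite /geometric /= sub0r normrN exprVn => h; exists m.
  exact: le_lt_trans (ler_norm _) h.
(* Agreement below [m] fixes the first [m] digits, as k / p <= k. *)
apply: filterS (near_cylinder z m) => z' hz.
have e2 : block_sum R p z' m = block_sum R p z m.
  by apply: eq_bigr => k _; rewrite hz// (leq_ltn_trans (leq_div _ _)).
apply: le_lt_trans hm; rewrite ler_norml.
by have := hf z m; have := hf z' m; rewrite e2; lra.
Qed.

Lemma block_limit_cantor (R : realType) p (f : cantor_space -> R) :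
  (0 < p)%N -> block_limit p f -> is_cantor_set (range f).
Proof.
move=> p0 hf; have f_inj : injective f.
  move=> z z' e; apply/funext => j.
  apply: (block_limit_separation p0 hf).
  by rewrite e subrr normr0 invr_gt0 mulr_gt0 ?exprn_gt0.
pose g y : cantor_space := xget point [set z | f z = y].
have fK : cancel f g.
  by move=> z; apply: f_inj; apply: (@xgetPex _ point [set z' | f z' = f z]); exists z.
exists f, g; split => //; first exact: block_limit_continuous hf.
apply/subspace_continuousP => _ [z _ <-]; apply: cvg_cantor_space => j.
have e0 : 0 < (4 * 10 ^+ (j * p))^-1 :> R by rewrite invr_gt0 mulr_gt0 ?exprn_gt0.
have /= := @nbhsx_ballx _ _ (f z) _ e0.
rewrite /within /=; apply: filterS => y h [z' _ yE]; move: h; rewrite -yE => h.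
change (g (f z') j = g (f z) j); rewrite !fK.
by apply/esym/(block_limit_separation p0 hf).
Qed.

(** * The compact sets A_i and the upper bound *)

Definition near_int (R : realType) : set R :=
  [set y | exists m : int, m%:~R <= y <= m%:~R + 1 / 5].

Lemma near_int_closed (R : realType) : closed (@near_int R).
Proof.
rewrite -[@near_int R]setCK; apply: open_closedC.
have -> : ~` @near_int R = \bigcup_(m : int) `]m%:~R + 1 / 5, m%:~R + 1[%classic.
  apply/seteqP; split=> [y yN|y [m _] /=].
    exists (Num.floor y) => //=; rewrite in_itv/= -[1 in X in _ && X]/(1%:~R) -intrD.
    rewrite floorD1_gt andbT ltNge; apply/negP => h; apply: yN.
    by exists (Num.floor y); rewrite floor_le h.
  rewrite in_itv/= => /andP[h1 h2] [i /andP[h3 h4]].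
  have : (i < m + 1)%R by rewrite -(ltr_int R) intrD; lra.
  rewrite ltzD1 -(ler_int R) => ?; lra.
by apply: bigcup_open => m _; exact: interval_open.
Qed.

Definition residue_set (R : realType) (p i : nat) : set R :=
  `[- 5, 5]%classic `&`
  \bigcap_(k in [set k | (k %% p)%N = i]) [set x | near_int (10 ^+ k * x)].

Lemma residue_set_compact (R : realType) p i : compact (@residue_set R p i).
Proof.
apply: compact_closedI; first exact: segment_compact.
apply: closed_bigI => k _.
have /continuous_closedP : continuous ( *%R (10 ^+ k) : R -> R).
  exact: mulrl_continuous.
by apply; exact: near_int_closed.
Qed.

(** If [z] and [z'] differ at [j], take k = j p + i, which lies in block [j] and has residue [i].
    Membership puts the scaled difference within 1/5 of an integer, the gap lemma within 1/5 of a
    half-integer, and 2/5 < 1/2. *)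
Lemma residue_set_cantor_inj (R : realType) p i (f : cantor_space -> R) x z z' :
  (i < p)%N -> block_limit p f ->
  residue_set p i (f z + x) -> residue_set p i (f z' + x) -> z = z'.
Proof.
move=> ip hf [_ az] [_ az']; apply/funext => j; apply/eqP/negPn/negP => ne.
have p0 : (0 < p)%N by case: (p) ip.
have dk : ((j * p + i) %/ p)%N = j by rewrite divnMDl// divn_small// addn0.
have mk : ((j * p + i) %% p)%N = i by rewrite modnMDl modn_small.
have [m1 h1] := az _ mk; have [m2 h2] := az' _ mk.
rewrite -dk in ne; have [m] := block_limit_gap hf ne.
have := half_dist_int R (m - m1 + m2); rewrite /= in h1 h2.
rewrite intrD intrB ler_norml => h /andP[h3 h4].
have : `|m%:~R - m1%:~R + m2%:~R + 1 / 2| <= 2 / 5 :> R; last lra.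
by rewrite ler_norml; lra.
Qed.

Lemma haar_bigcup (R : realType) m (A : 'I_m.+1 -> set R) (D : set R) :
  is_cantor_set D -> (forall i, closed (A i)) ->
  (forall x i a b, translate D x a -> translate D x b -> A i a -> A i b -> a = b) ->
  haar m.+1 (\bigcup_i A i).
Proof.
move=> cD clA AD; exists (\bigcup_i A i), D; split => //.
  have clU : closed (\bigcup_i A i) by apply: closed_bigcup => //; exact: finite_finset.
  rewrite -[X in <<s _ >> X]setCK -setTD; apply: sigma_algebraCD.
  by apply: sub_sigma_algebra; rewrite openC.
move=> x; apply/pcard_leP/injfunPex.
(* Each point is sent to the index of some [A i] containing it; the default [ord0] is never taken on
   the union. *)
exists (fun a => val (xget ord0 [set i | A i a])) => [a _ /=|a b].
  exact: ltn_ord.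
rewrite !inE => -[Da [i _ Aia]] [Db [i' _ Aib]] /val_inj e.
have ha := @xgetPex _ ord0 [set i | A i a] (ex_intro _ i Aia).
have hb := @xgetPex _ ord0 [set i | A i b] (ex_intro _ i' Aib).
by rewrite /= -e in hb; exact: (AD x _ _ _ Da Db ha hb).
Qed.

(** * Simultaneous translation and the lower bound *)

Lemma cantor_set_close_points (R : realType) (D : set R) : is_cantor_set D ->
  exists (c : R) (d : nat -> R),
    injective d /\ forall i, D (d i) /\ `|d i - c| <= 1.
Proof.
move=> [f [g [cf <- fK _]]].
(* The indicators of single indices are distinct and converge to [zero], so their images cluster at
   [f zero]. *)
pose delta k : cantor_space := fun j => j == k.
pose zero : cantor_space := fun=> false.
have delta_cvg : delta k @[k --> \oo] --> zero.
  apply: cvg_cantor_space => j; exists j.+1 => // k /= jk.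
  by rewrite /delta /zero; case: eqP jk => // ->; rewrite ltnn.
have : f (delta k) @[k --> \oo] --> f zero by apply: cvg_comp delta_cvg (cf zero).
move=> /cvgrPdist_le/(_ _ ltr01)[N _ hN].
exists (f zero), (fun i => f (delta (N + i)%N)); split=> [i j|i].
  move=> /(can_inj fK)/(congr1 (fun z : cantor_space => z (N + i)%N)).
  by rewrite /delta eqxx => /esym/eqP/addnI.
by split; [exists (delta (N + i)%N)|rewrite distrC; apply: hN => /=; exact: leq_addr].
Qed.

(* Having fixed [u k], move right to the next point for which [10^k (t + u)] is an
   integer, [t] being the shift whose index is [k] mod [p]; later moves add at
   most [2 / 10^(k+1)], that is 1/5 after scaling by [10^k]. *)
Lemma residue_sets_translate (R : realType) p (t : nat -> R) :
  (forall i, `|t i| <= 1) ->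
  exists x, forall i, residue_set p i (t i + x).
Proof.
move=> ht; pose u k := iteri k (fun k v =>
  (Num.ceil (10 ^+ k * (t (k %% p)%N + v)))%:~R / 10 ^+ k - t (k %% p)%N) 0.
have uS k : u k.+1 = (Num.ceil (10 ^+ k * (t (k %% p)%N + u k)))%:~R / 10 ^+ k
  - t (k %% p)%N by [].
have [|x hx] := @nested_decimal R u.
  move=> k; rewrite uS; set q := 10 ^+ k; set s := t _.
  have q0 : 0 < q by rewrite exprn_gt0.
  have /andP[] := ceil_itv (q * (s + u k)); rewrite intrB; set c := _%:~R.
  rewrite -[X in _ <= X](divfK (lt0r_neq0 q0)) => + h2.
  rewrite -[X in X < _](divfK (lt0r_neq0 q0)) => h1.
  move: h1 h2; rewrite ![_ / q * q]mulrC !ltr_pM2l ?ler_pM2l//.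
  by rewrite mulrDl mulrC; lra.
exists x => i; split=> /=.
  (* Since [u 0] is 0, [x] lies in [0, 2], so [t i + x] lies in [-1, 3]. *)
  have := hx 0%N; rewrite in_itv /= expr0 /u /=.
  by have := ht i; rewrite ler_norml; lra.
move=> k /= <-; have := hx k.+1; rewrite uS; set q := 10 ^+ k; set s := t _.
have q0 : 0 < q :> R by rewrite exprn_gt0.
set c := Num.ceil _ => /andP[h1 h2]; exists c.
have -> : c%:~R = q * (c%:~R / q - s + s) :> R by field; rewrite lt0r_neq0.
have -> : 1 / 5 = q * (2 / 10 ^+ k.+1) :> R.
  by rewrite exprS -/q; field; rewrite lt0r_neq0.
by rewrite -mulrDr !ler_pM2l//; lra.
Qed.

Unset Implicit Arguments.

Theorem theorem5p1 (R : realType) (n : nat) (hn : (0 < n)%N) :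
  (exists A : 'I_n.+1 -> set R,
      (forall i, compact (A i) /\ haar 1 (A i)) /\
      haar n.+1 (\bigcup_i A i) /\
      ~ haar n (\bigcup_i A i)) /\
  (exists C : set R, closed C /\ haar n.+1 C /\ ~ haar n C).
Proof.
pose A (i : 'I_n.+1) := @residue_set R n.+1 i.
have Acl i : closed (A i).
  apply: compact_closed; [exact: norm_hausdorff|exact: residue_set_compact].
have [f hf] := block_limit_exists R n.+1.
have fC := block_limit_cantor (ltn0Sn n) hf.
have AD x (i : 'I_n.+1) a b : translate (range f) x a -> translate (range f) x b ->
    A i a -> A i b -> a = b.
  move=> [_ [z _ <-] <-] [_ [z' _ <-] <-] ha hb.
  by rewrite (residue_set_cantor_inj (ltn_ord i) hf ha hb).
have haarS : haar n.+1 (\bigcup_i A i) by exact: haar_bigcup fC Acl AD.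
have not_haar : ~ haar n (\bigcup_i A i).
  move=> [B [D [_ AB cD hD]]].
  have [c [d [d_inj hd]]] := cantor_set_close_points cD.
  (* Translation by [x - c] sends [d i] to [(d i - c) + x], a point of [A i]; thus n + 1 points of
     one translate of [D] lie in [B]. *)
  have [i|x hx] := @residue_sets_translate R n.+1 (fun i => d i - c).
    by have [] := hd i.
  suff : (`I_n.+1 #<= `I_n)%card by rewrite card_le_II ltnn.
  apply: card_le_trans (hD (x - c)); apply/pcard_leP/injfunPex.
  exists (fun i => d i + (x - c)) => [i /= ip|i j _ _ /addIr/d_inj//].
  split; first by exists (d i) => //; have [] := hd i.
  by apply: AB; exists (Ordinal ip) => //; have := hx i; rewrite addrA addrAC.
split; last first.
  exists (\bigcup_i A i); split=> //.
  by apply: closed_bigcup => //; exact: finite_finset.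
exists A; split=> // i; split; first exact: residue_set_compact.
(* Viewed as a union over ['I_1], a single [A i] is Haar-1 by the same counting. *)
have -> : A i = \bigcup_(j : 'I_1) A i by rewrite bigcup_const//; exists ord0.
apply: haar_bigcup fC _ _ => // x _; exact: AD.
Qed.
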